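(* Let $n\ge 2$ be an integer, let $A\subseteq\mathbb{F}_{2^{n-1}}\setminus\{0\}$ with $|A|=k<2^{n-1}-4$, and let $\overline{A}^*$ be the complement of $A$ in $\mathbb{F}_{2^{n-1}}\setminus\{0\}$. Suppose $r(\overline{A}^* )>0$. Then there exists a subset of $\mathbb{F}_{2^n}\setminus\{0\}$ of size $k+4$ whose $r$-value is $r(A)$.
   Context: For a subset $X$ of a finite additive abelian group, the $r$-value $r(X)$ is the number of ordered pairs $(x,y)\in X\times X$ with $x+y\in X$. Only the additive group of $\mathbb{F}_{2^n}$ is used: its elements are written as vectors $[\alpha_1,\dots,\alpha_n]$ with $\alpha_i\in\{0,1\}$ and addition coordinatewise modulo 2. By convention $\mathbb{F}_{2^{n-1}}$ is regarded as the subset of $\mathbb{F}_{2^n}$ consisting of the vectors with first coordinate $\alpha_1=0$. *)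

(* Defs.v *)
From HB Require Import structures.
From mathcomp Require Import all_boot all_order all_algebra.
Set Implicit Arguments.
Unset Strict Implicit.
Unset Printing Implicit Defensive.
Import GRing.Theory.
Local Open Scope ring_scope.

Definition r_value (V : finZmodType) (X : {set V}) : nat :=
  #|[set p : V * V | [&& p.1 \in X, p.2 \in X & p.1 + p.2 \in X]]|.

(* Only the additive group of the field with 2 ^ n elements matters, so its
   elements are row vectors over 'F_2. The field with 2 ^ (n - 1) elements is
   the set of vectors whose first coordinate, of index 0, vanishes; testing
   the index as a nat keeps the length n arbitrary. *)
Definition subF (n : nat) : {set 'rV['F_2]_n} :=
  [set v : 'rV['F_2]_n | [forall i : 'I_n, (val i == 0%N) ==> (v 0 i == 0)]].

Definition compl_star (n : nat) (A : {set 'rV['F_2]_n}) : {set 'rV['F_2]_n} :=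
  (subF n :\ 0) :\: A.

(* Main.v *)
Require Import Defs.
From HB Require Import structures.
From mathcomp Require Import all_boot all_order all_algebra.
Set Implicit Arguments.
Unset Strict Implicit.
Unset Printing Implicit Defensive.
Import GRing.Theory.
Local Open Scope ring_scope.

(** A solution x + y = z inside the complement of A makes K = {0, x, y, z} a
    subgroup of order 4 disjoint from A: positivity of r at the complement says
    exactly that such a Klein four-group exists, its four elements being
    distinct because 0 is excluded from the complement. Take a vector u whose
    first coordinate is 1 and adjoin the coset u + K to A. The first coordinate
    is additive, so a solution of a + b = c in the enlarged set that is not
    inside A involves exactly two elements of u + K and one of A. In
    characteristic 2 the latter is the sum of the former, hence lies in K, which
    is disjoint from A. So no solution is created, and four nonzero elements
    have been added. *)

Lemma addvv_F2 (m n : nat) (v : 'M['F_2]_(m, n)) : v + v = 0.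
Proof.
apply/matrixP => i j; rewrite !mxE -mulr2n.
by rewrite mulrn_pchar // pchar_Fp.
Qed.

(** The map f plays the part of a parity: a sum relation has an even number of
    odd members, so a new relation has the form t + t' = a up to the order of
    its terms, since signs do not matter. *)
Lemma r_value_setU_odd (V : finZmodType) (f : V -> 'F_2) (A T : {set V}) :
  {morph f : u v / u + v} ->
  (forall v : V, v + v = 0) ->
  {in A, forall a, f a = 0} -> {in T, forall t, f t = 1} ->
  {in T &, forall t t', t + t' \notin A} ->
  r_value (A :|: T) = r_value A.
Proof.
move=> fD addvv fA fT TTA.
have sumE (a b c : V) : a + b = c -> a = b + c.
  by move=> <-; rewrite addrCA addvv addr0.
apply: eq_card => -[a b]; rewrite !inE /=.
apply/idP/and3P => [|[-> -> ->] //].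
case/and3P=> /orP[aA|aT] /orP[bA|bT] /orP[cA|cT]; first by split.
all: exfalso.
- by move: (fT _ cT); rewrite fD (fA _ aA) (fA _ bA).
- by move: (fA _ cA); rewrite fD (fA _ aA) (fT _ bT).
- by move: (TTA _ _ bT cT); rewrite -(sumE a b _ erefl) aA.
- by move: (fA _ cA); rewrite fD (fT _ aT) (fA _ bA).
- by move: (TTA _ _ aT cT); rewrite addrA addvv add0r bA.
- by move: (TTA _ _ aT bT); rewrite cA.
- by move: (fT _ cT); rewrite fD (fT _ aT) (fT _ bT).
Qed.

Definition klein4 (V : finZmodType) (x y : V) : {set V} :=
  [set 0; x; y; x + y].

Lemma klein4D (V : finZmodType) (x y : V) :
  (forall v : V, v + v = 0) ->
  {in klein4 x y &, forall a b, a + b \in klein4 x y}.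
Proof.
move=> addvv a b; rewrite !inE -!orbA.
have xxy : x + (x + y) = y by rewrite addrA addvv add0r.
have yxy : y + (x + y) = x by rewrite addrCA addvv addr0.
by case/or4P=> /eqP-> /or4P[] /eqP->;
   rewrite ?add0r ?addr0 ?addvv ?xxy ?yxy ?[y + x]addrC
     ?[x + y + _]addrC ?xxy ?yxy ?eqxx ?orbT.
Qed.

Lemma card_klein4 (V : finZmodType) (x y : V) :
  x != 0 -> y != 0 -> x + y != 0 -> x != y -> #|klein4 x y| = 4%N.
Proof.
move=> x0 y0 xy0 xy.
have xxy : (x == x + y) = false.
  by rewrite -subr_eq0 opprD addrA subrr add0r oppr_eq0 (negPf y0).
have yxy : (y == x + y) = false.
  by rewrite -subr_eq0 opprD addrCA subrr addr0 oppr_eq0 (negPf x0).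
rewrite /klein4 -!setUA !cardsU1 cards1 !inE ![0 == _]eq_sym.
by rewrite (negPf x0) (negPf y0) (negPf xy0) (negPf xy) xxy yxy.
Qed.

Theorem proposition4p12 (n : nat) (hn : (2 <= n)%N)
    (A : {set 'rV['F_2]_n}) (k : nat)
    (hA : A \subset subF n :\ 0)
    (hk : #|A| = k) (hkn : (k < 2 ^ (n - 1) - 4)%N)
    (hr : (0 < r_value (compl_star A))%N) :
  exists B : {set 'rV['F_2]_n},
    [/\ B \subset [set: 'rV['F_2]_n] :\ 0,
        #|B| = (k + 4)%N
      & r_value B = r_value A].
Proof.
pose i0 := Ordinal (ltnW hn).
pose f (v : 'rV['F_2]_n) := v 0 i0.
pose u : 'rV['F_2]_n := delta_mx 0 i0.
have fD : {morph f : v w / v + w} by move=> v w; rewrite /f mxE.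
have f0 : f 0 = 0 by rewrite /f mxE.
have fu : f u = 1 by rewrite /f mxE !eqxx.
have addvv := @addvv_F2 1 n.
have fsub : {in subF n, forall v, f v = 0}.
  by move=> v; rewrite inE => /forallP/(_ i0)/eqP.
have fA : {in A, forall a, f a = 0}.
  by move=> a /(subsetP hA); rewrite inE => /andP[_ /fsub].
have A0 : 0 \notin A.
  by apply/negP => /(subsetP hA); rewrite !inE eqxx.
case/card_gt0P: hr => -[x y].
have complP v : v \in compl_star A -> [/\ v \notin A, v != 0 & f v = 0].
  by rewrite /compl_star in_setD in_setD1 => /and3P[? ? /fsub].
rewrite inE /= => /and3P[/complP[xA x0 fx] /complP[yA y0 fy]].
case/complP=> xyA xy0 fxy.
have xy : x != y by apply: contraNneq xy0 => ->; rewrite addvv.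
have KA : {in klein4 x y, forall w, w \notin A}.
  by move=> w; rewrite !inE -!orbA => /or4P[] /eqP->.
have fK : {in klein4 x y, forall w, f w = 0}.
  by move=> w; rewrite !inE -!orbA => /or4P[] /eqP->.
pose T := [set u + w | w in klein4 x y].
have fT : {in T, forall t, f t = 1}.
  by move=> _ /imsetP[w wK ->]; rewrite fD fu (fK _ wK) addr0.
have TTA : {in T &, forall t t', t + t' \notin A}.
  move=> _ _ /imsetP[w wK ->] /imsetP[w' wK' ->].
  by rewrite addrACA addvv add0r; apply/KA/klein4D.
have disjAT : [disjoint A & T].
  apply/pred0P => v /=; apply/negP => /andP[vA vT].
  by move: (fT _ vT); rewrite (fA _ vA).
exists (A :|: T); split.
- rewrite subsetD1 subsetT inE (negPf A0) /=.
  by apply/negP => /fT; rewrite f0.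
- rewrite cardsU disjoint_setI0 // cards0 subn0 hk card_imset; last exact: addrI.
  by rewrite card_klein4.
- exact: (r_value_setU_odd fD).
Qed.
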